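(* Let $(u^j,p^j;\lambda^j)$, $j\ge0$, be the iterates of the Generalized ADMM (defined in the context), and suppose that the step sizes satisfy the monotonicity property $\tau_{j+1}\le\tau_j$ for all $j\ge1$. Then $$R_J^2=\mathcal{O}\Bigl(\frac1J\Bigr)\qquad\text{as } J\to\infty .$$
   Context: $X,Y$ are real Hilbert spaces with inner products $(\cdot,\cdot)_X,(\cdot,\cdot)_Y$, identified with their duals. $F:Y\to\mathbb{R}\cup\{+\infty\}$ and $G:X\to\mathbb{R}\cup\{+\infty\}$ are convex, proper and lower semicontinuous, and $B:X\to Y$ is a bounded linear operator such that $u\mapsto F(Bu)+G(u)$ is proper and coercive. For $\tau>0$, $$\mathcal{L}_\tau(u,p;\lambda)=F(p)+G(u)+(\lambda,Bu-p)_Y+\frac{\tau}{2}\|Bu-p\|_Y^2 ,$$ and $(u,p;\lambda)\in X\times Y\times Y$ is a saddle point of $\mathcal{L}_\tau$ if $\mathcal{L}_\tau(u,p;\mu)\le\mathcal{L}_\tau(u,p;\lambda)\le\mathcal{L}_\tau(v,q;\lambda)$ for all $(v,q,\mu)\in X\times Y\times Y$. It is assumed that a saddle point exists. Generalized ADMM: choose $(u^0,\lambda^0)\in X\times Y$ with $G(u^0)<\infty$, $\overline{\tau}\ge\underline{\tau}>0$, and set $\tau_1=\overline{\tau}$. For $j=1,2,\dots$: compute a minimizer $p^j\in Y$ of $p\mapsto\mathcal{L}_{\tau_j}(u^{j-1},p;\lambda^{j-1})$; compute a minimizer $u^j\in X$ of $u\mapsto\mathcal{L}_{\tau_j}(u,p^j;\lambda^{j-1})$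 (minimizers are assumed to exist); set $\lambda^j=\lambda^{j-1}+\tau_j(Bu^j-p^j)$; define the residual $R_j=\bigl(\|\lambda^j-\lambda^{j-1}\|_Y^2+\tau_j^2\|B(u^j-u^{j-1})\|_Y^2\bigr)^{1/2}$; choose $\tau_{j+1}\in[\underline{\tau},\overline{\tau}]$. The iterates are regarded as an infinite sequence (the stopping test is ignored). *)

(* Defs.v *)
From HB Require Import structures.
From mathcomp Require Import all_boot all_order all_algebra.
From mathcomp Require Import all_classical all_reals all_analysis.

Set Implicit Arguments.
Unset Strict Implicit.
Unset Printing Implicit Defensive.

Import Order.TTheory GRing.Theory Num.Theory.
Import numFieldNormedType.Exports.

Local Open Scope classical_set_scope.
Local Open Scope ring_scope.

(* A real Hilbert space is encoded as a [completeNormedModType R] together with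
   a real inner product [ip : {dot X for idfun}] (bilinear, symmetric, positive
   definite) that induces the norm of [X]. *)
Definition induces_norm (R : realType) (X : normedModType R)
    (ip : {dot X for idfun}) : Prop :=
  forall x : X, `|x| ^+ 2 = ip x x.

(* Functionals X -> R U {+oo} are functions to [\bar R] that avoid [-oo]; this
   is part of [proper_fun]. *)
Section ExtendedFunctionals.
Local Open Scope ereal_scope.
Context (R : realType) (X : normedModType R).
Implicit Types f : X -> \bar R.

Definition proper_fun f : Prop :=
  (forall x, f x != -oo) /\ (exists x, f x < +oo).

Definition convex_fun f : Prop :=
  forall (x y : X) (t : R), (0 < t < 1)%R ->
    f (t *: x + (1 - t) *: y)%R <= t%:E * f x + (1 - t)%:E * f y.

(* f x --> +oo as `|x| --> +oo *)
Definition coercive f : Prop :=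
  forall A : R, exists r : R, forall x : X, (r <= `|x|)%R -> A%:E <= f x.

Definition minimizer (T : Type) (f : T -> \bar R) (x : T) : Prop :=
  forall y, f x <= f y.

End ExtendedFunctionals.

Section ADMM.
Context (R : realType) (X Y : normedModType R) (ipY : {dot Y for idfun}).
Context (F : Y -> \bar R) (G : X -> \bar R) (B : {linear X -> Y}).

Definition aug_lagrangian (tau : R) (u : X) (p lam : Y) : \bar R :=
  (F p + G u + (ipY lam (B u - p) + tau / 2 * `|B u - p| ^+ 2)%:E)%E.

Definition saddle_point (tau : R) (u : X) (p lam : Y) : Prop :=
  forall (v : X) (q mu : Y),
    (aug_lagrangian tau u p mu <= aug_lagrangian tau u p lam)%E /\
    (aug_lagrangian tau u p lam <= aug_lagrangian tau v q lam)%E.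

(* [tau 0] and [p 0] play no role: step sizes and p-iterates start at 1. *)
Record generalized_ADMM (taumin taumax : R)
    (tau : nat -> R) (u : nat -> X) (p lam : nat -> Y) : Prop := {
  admm_init : (G (u 0%N) < +oo)%E ;
  admm_taumin_gt0 : 0 < taumin ;
  admm_taumin_le : taumin <= taumax ;
  admm_tau1 : tau 1%N = taumax ;
  admm_tau : forall j, (1 <= j)%N -> taumin <= tau j.+1 <= taumax ;
  admm_p : forall j, (1 <= j)%N ->
    minimizer (fun q => aug_lagrangian (tau j) (u j.-1) q (lam j.-1)) (p j) ;
  admm_u : forall j, (1 <= j)%N ->
    minimizer (fun v => aug_lagrangian (tau j) v (p j) (lam j.-1)) (u j) ;
  admm_lam : forall j, (1 <= j)%N ->
    lam j = lam j.-1 + tau j *: (B (u j) - p j)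
}.

Definition residual (tau : nat -> R) (u : nat -> X) (lam : nat -> Y)
    (j : nat) : R :=
  Num.sqrt (`|lam j - lam j.-1| ^+ 2
            + tau j ^+ 2 * `|B (u j - u j.-1)| ^+ 2).

End ADMM.

(* Main.v *)
Require Import Defs.
From HB Require Import structures.
From mathcomp Require Import all_boot all_order all_algebra.
From mathcomp Require Import all_classical all_reals all_analysis.
From mathcomp Require Import ring lra.

Set Implicit Arguments.
Unset Strict Implicit.
Unset Printing Implicit Defensive.

Import Order.TTheory GRing.Theory Num.Theory.
Import numFieldNormedType.Exports.

Local Open Scope classical_set_scope.
Local Open Scope ring_scope.

(* The optimality conditions of the two subproblems say that [- B^* lam_j] is a
   subgradient of [G] at [u_j] and [lam_j - tau_j B (u_j - u_{j-1})] one of [F]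
   at [p_j]. Monotonicity of the subdifferentials between an iterate and the
   saddle point shows that [|lam_j - lam|^2 + tau_{j+1}^2 |B (u_j - u)|^2]
   decreases by at least [R_j^2] in each step, so the [R_j^2] are summable;
   monotonicity between consecutive iterates shows that [R_j] is nonincreasing.
   Hence [(J - 1) R_J^2] is bounded. Since [u_0] satisfies no optimality
   condition, the energy argument starts at [j = 2]. *)

(** * Subgradients and first-order optimality *)

Section Subgradient.
Context (R : realType) (V : normedModType R).
Implicit Types (f : V -> \bar R) (l : V -> R).

Definition subgradient f x l : Prop :=
  f x \is a fin_num /\ forall v, (f x + (l (v - x))%:E <= f v)%E.

Lemma subgradient_monotone f x y l m :
  subgradient f x l -> subgradient f y m -> l (y - x) + m (x - y) <= 0.
Proof.
move=> [fx /(_ y) +] [fy /(_ x)].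
rewrite -(fineK fx) -(fineK fy) -!EFinD !lee_fin; lra.
Qed.

Lemma le0_of_le_scale (a b : R) :
  (forall t, 0 < t < 1 -> a <= t * b) -> a <= 0.
Proof.
move=> ab; rewrite leNgt; apply/negP => a_gt0.
have b_ge0 : 0 <= `|b| by [].
have d_gt0 : 0 < 2 * (a + `|b|) by lra.
(* This [t] is small enough that [t * b <= a / 2], against [a <= t * b]. *)
have /ab : 0 < a / (2 * (a + `|b|)) < 1.
  by rewrite divr_gt0//= ltr_pdivrMr// mul1r; lra.
rewrite mulrAC ler_pdivlMr// => h.
have : a * b <= a * `|b| by rewrite ler_pM2l// ler_norm.
have : 0 < a * a by rewrite mulr_gt0.
have : 0 <= a * `|b| by rewrite mulr_ge0// ltW.
lra.
Qed.

(* [- l] is the derivative of [phi] at [x]; the remainder [c] drops out as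
   [t -> 0]. *)
Lemma minimizer_subgradient f (phi : V -> R) x l (c : V -> R) :
  convex_fun f -> (forall v, f v != -oo%E) -> f x \is a fin_num ->
  (forall v t, phi (t *: v + (1 - t) *: x)
               = phi x + t * (- l (v - x) + t * c v)) ->
  minimizer (fun v => (f v + (phi v)%:E)%E) x ->
  subgradient f x l.
Proof.
move=> fconv fNy fx phiE xmin; split=> // v.
case fv: (f v) (fNy v) => [b||]// _; last by rewrite leey.
rewrite -(fineK fx) -EFinD lee_fin -subr_le0.
apply: (@le0_of_le_scale _ (c v)) => t t01.
have := le_trans (xmin (t *: v + (1 - t) *: x)) (leeD2r _ (fconv v x t t01)).
rewrite -(fineK fx) fv -!EFinM -!EFinD lee_fin phiE => h.
have t_gt0 : 0 < t by case/andP: t01.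
rewrite -(ler_pM2l t_gt0); lra.
Qed.

End Subgradient.

(** * Inner-product inequalities behind the two decrease estimates *)

Section DotProduct.
Context (R : realType) (Y : normedModType R) (ip : {dot Y for idfun}).
Context (ip_norm : induces_norm ip).

Lemma dotC x y : ip x y = ip y x.
Proof. by rewrite hermC expr0 mul1r. Qed.

Lemma dotZr a x y : ip x (a *: y) = a * ip x y.
Proof. by rewrite linearZr_LR. Qed.

Lemma dotZl a x y : ip (a *: x) y = a * ip x y.
Proof. by rewrite dotC dotZr dotC. Qed.

Lemma dotDr x y z : ip x (y + z) = ip x y + ip x z.
Proof. exact: linearDr. Qed.

Lemma dotDl x y z : ip (x + y) z = ip x z + ip y z.
Proof. exact: linearDl. Qed.

Lemma dotNr x y : ip x (- y) = - ip x y.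
Proof. exact: linearNr. Qed.

Lemma dotNl x y : ip (- x) y = - ip x y.
Proof. exact: linearNl. Qed.

Definition dotE := (dotDr, dotDl, dotNr, dotNl, dotZr, dotZl).

Lemma dot_ge0 x : 0 <= ip x x.
Proof. by rewrite -ip_norm sqr_ge0. Qed.

(* With [e = lam_j - lam], [x = B (u_j - u)], [q = p_j - p] and [e0], [x0] the
   previous values of [e], [x]. *)
Lemma energy_decrease (tau : R) (e0 e x0 x q : Y) :
  0 < tau -> e = e0 + tau *: (x - q) ->
  ip (e - e0) (x - x0) <= 0 ->
  0 <= ip (e - tau *: (x - x0)) q - ip e x ->
  ip (e - e0) (e - e0) + tau ^+ 2 * ip (x - x0) (x - x0)
    + (ip e e + tau ^+ 2 * ip x x) <= ip e0 e0 + tau ^+ 2 * ip x0 x0.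
Proof.
move=> tau0 -> h1 h2.
(* By polarization, left side minus right side is exactly [2 * tau] times the difference of the
   quantities in [h1] and [h2]. *)
have := mulr_ge0_le0 (ltW tau0) h1; have := mulr_ge0 (ltW tau0) h2.
rewrite !dotE ?(dotC x e0) ?(dotC q e0) ?(dotC x x0) ?(dotC q x0) ?(dotC q x).
lra.
Qed.

(* With [a = B u_j - p_j], [w = B (u_j - u_{j-1})], and [a'], [w'], [tau'] the
   corresponding quantities at step [j + 1]. *)
Lemma residual_decrease (tau tau' : R) (a w a' w' : Y) :
  0 < tau' -> tau' <= tau ->
  ip (tau' *: a') w' <= 0 ->
  0 <= ip (tau' *: (a' - w') + tau *: w) (w' - a' + a) ->
  ip (tau' *: a') (tau' *: a') + tau' ^+ 2 * ip w' w'
    <= ip (tau *: a) (tau *: a) + tau ^+ 2 * ip w w.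
Proof.
move=> tau'0 tau'_le h1 h2.
have tau_sq : tau' ^+ 2 * ip a a <= tau ^+ 2 * ip a a.
  by rewrite ler_wpM2r ?dot_ge0// ler_sqr ?nnegrE; lra.
have := mulr_ge0 (ltW tau'0) h2.
have := mulr_ge0_le0 (ltW tau'0) h1.
(* Put d = tau' (a' - w'), b = tau' a, c = tau w. Then [h2] times tau' reads |d|^2 <= (d, b - c) +
   (b, c), which this square turns into |d|^2 <= |b|^2 + |c|^2. By [h1], |tau' a'|^2 + |tau' w'|^2
   <= |d|^2. *)
have := dot_ge0 (tau' *: (a' - w') - (tau' *: a - tau *: w)).
move: tau_sq; rewrite !dotE ?(dotC w a) ?(dotC a' a) ?(dotC w' a) ?(dotC a' w)
  ?(dotC w' w) ?(dotC w' a').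
lra.
Qed.

End DotProduct.

(** * Optimality conditions of the subproblems and of the saddle point *)

Section AugmentedLagrangian.
Context (R : realType) (X Y : normedModType R) (ip : {dot Y for idfun}).
Context (ip_norm : induces_norm ip).
Context (F : Y -> \bar R) (G : X -> \bar R) (B : {linear X -> Y}).
Context (F_proper : proper_fun F) (G_proper : proper_fun G).
Context (F_convex : convex_fun F) (G_convex : convex_fun G).
Implicit Types (tau : R) (u v : X) (p q lam : Y).

Local Notation L := (aug_lagrangian ip F G B).

Lemma proper_fin_num (V : normedModType R) (f : V -> \bar R) x :
  proper_fun f -> (f x < +oo)%E -> f x \is a fin_num.
Proof. by move=> [fNy _] fx; rewrite fin_numElt ltNye fNy. Qed.

(** The smooth part is quadratic in [p], so its expansion along a segment is exact, with remainder
    [tau / 2] times a squared norm. Finiteness of [G u] lets that constant cancel. *)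
Lemma minimizer_p_subgradient tau u p lam : G u \is a fin_num ->
  minimizer (fun q => L tau u q lam) p ->
  subgradient F p (ip (lam + tau *: (B u - p))).
Proof.
move=> Gu pmin.
have F_p : F p \is a fin_num.
  have [_ [q Fq]] := F_proper.
  apply: proper_fin_num => //; have := pmin q.
  rewrite /aug_lagrangian -(fineK Gu) -(fineK (proper_fin_num F_proper Fq)).
  by case: (F p) => // r; rewrite ltry.
pose phi q := ip lam (B u - q) + tau / 2 * `|B u - q| ^+ 2.
apply: (@minimizer_subgradient _ _ F phi _ _
  (fun q => tau / 2 * ip (q - p) (q - p))) => //.
- by case: F_proper.
- move=> q t; rewrite /phi !ip_norm.
  rewrite !(dotE ip) (dotC ip q (B u)) (dotC ip p (B u)) (dotC ip p q); lra.
- move=> q; have := pmin q; rewrite /aug_lagrangian /= -/(phi p) -/(phi q).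
  by rewrite addeAC (addeAC (F q)) leeD2rE.
Qed.

(** The functional is [- B^* (lam + tau *: (B u - p))], written through [B] so that no adjoint has
    to be formed. *)
Lemma minimizer_u_subgradient tau u p lam : F p \is a fin_num ->
  minimizer (fun v => L tau v p lam) u ->
  subgradient G u (fun v => - ip (lam + tau *: (B u - p)) (B v)).
Proof.
move=> Fp umin.
have G_u : G u \is a fin_num.
  have [_ [v Gv]] := G_proper.
  apply: proper_fin_num => //; have := umin v.
  rewrite /aug_lagrangian -(fineK Fp) -(fineK (proper_fin_num G_proper Gv)).
  by case: (G u) => // r; rewrite ltry.
pose phi v := ip lam (B v - p) + tau / 2 * `|B v - p| ^+ 2.
apply: (@minimizer_subgradient _ _ G phi _ _
  (fun v => tau / 2 * ip (B (v - u)) (B (v - u)))) => //.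
- by case: G_proper.
- move=> v t; rewrite /phi !ip_norm.
  rewrite !linearB/= linearD/= !linearZ/= !(dotE ip).
  rewrite (dotC ip p (B u)) (dotC ip p (B v)) (dotC ip (B v) (B u)); lra.
- move=> v; have := umin v; rewrite /aug_lagrangian /= -/(phi u) -/(phi v).
  by rewrite -!addeA leeD2lE.
Qed.

(** Testing with the multiplier [lam + (B u - p)] forces [B u = p]. The penalty then has zero
    derivative, so [tau] drops out and need not match the step sizes of the iteration. *)
Lemma saddle_pointP tau u p lam : saddle_point ip F G B tau u p lam ->
  [/\ B u = p, subgradient F p (ip lam)
    & subgradient G u (fun v => - ip lam (B v))].
Proof.
move=> sad.
have [F_p G_u] : F p \is a fin_num /\ G u \is a fin_num.
  have [_ [q Fq]] := F_proper; have [_ [v Gv]] := G_proper.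
  have [_] := sad v q lam; rewrite /aug_lagrangian.
  rewrite -(fineK (proper_fin_num F_proper Fq)).
  rewrite -(fineK (proper_fin_num G_proper Gv)).
  case: (F p) (F_proper.1 p) => //; case: (G u) (G_proper.1 u) => //.
have Bup : B u - p = 0.
  have [+ _] := sad u p (lam + (B u - p)).
  rewrite /aug_lagrangian -(fineK F_p) -(fineK G_u) -!EFinD lee_fin.
  rewrite dotDl -ip_norm => h.
  by apply/eqP; rewrite -normr_eq0 -sqrf_eq0 eq_le sqr_ge0 andbT; lra.
have lamE : lam + tau *: (B u - p) = lam by rewrite Bup scaler0 addr0.
split; first by apply/eqP; rewrite -subr_eq0 Bup.
- by rewrite -lamE; apply: minimizer_p_subgradient => // q; case: (sad u q lam).
- by rewrite -lamE; apply: minimizer_u_subgradient => // v; case: (sad v p lam).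
Qed.

End AugmentedLagrangian.

Theorem corollary3p12 (R : realType) (X Y : completeNormedModType R)
    (ipX : {dot X for idfun}) (ipY : {dot Y for idfun})
    (hX : induces_norm ipX) (hY : induces_norm ipY)
    (F : Y -> \bar R) (G : X -> \bar R)
    (F_proper : proper_fun F) (F_convex : convex_fun F)
    (F_lsc : lower_semicontinuous F)
    (G_proper : proper_fun G) (G_convex : convex_fun G)
    (G_lsc : lower_semicontinuous G)
    (B : {linear X -> Y}) (B_bounded : bounded_near B (nbhs (0 : X)))
    (FG_proper : proper_fun (fun u => (F (B u) + G u)%E))
    (FG_coercive : coercive (fun u => (F (B u) + G u)%E))
    (saddle_exists : exists (tau : R) (u : X) (p lam : Y),
      0 < tau /\ saddle_point ipY F G B tau u p lam)
    (taumin taumax : R) (tau : nat -> R)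
    (u : nat -> X) (p lam : nat -> Y)
    (iterates : generalized_ADMM ipY F G B taumin taumax tau u p lam)
    (tau_mono : forall j, (1 <= j)%N -> tau j.+1 <= tau j) :
  (fun J : nat => residual B tau u lam J ^+ 2 : R^o)
    =O_\oo (fun J : nat => J%:R^-1 : R^o).
Proof.
have [tau_s [us [ps [lams [_ sad]]]]] := saddle_exists.
have [Bus subFs subGs] :=
  saddle_pointP hY F_proper G_proper F_convex G_convex sad.
case: iterates => G0 taumin_gt0 taumin_le tau1 tau_bd minp minu lamE.
have tau_gt0 j : 0 < tau j.+1.
  case: j => [|j]; first by rewrite tau1 (lt_le_trans taumin_gt0).
  by have /andP[h _] := tau_bd j.+1 isT; apply: lt_le_trans h.
(* Only finiteness of [G (u j)] is assumed, so that it propagates by induction from [u 0]. *)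
have step j : G (u j) \is a fin_num ->
    subgradient F (p j.+1) (ipY (lam j.+1 - tau j.+1 *: B (u j.+1 - u j))) /\
    subgradient G (u j.+1) (fun v => - ipY (lam j.+1) (B v)).
  move=> Guj.
  have subF :=
    minimizer_p_subgradient hY F_proper F_convex Guj (minp j.+1 isT).
  have subG :=
    minimizer_u_subgradient hY G_proper G_convex subF.1 (minu j.+1 isT).
  rewrite (lamE j.+1 isT) /=; split=> //.
  (* The p-step sees the old [u j]; passing to [lam j.+1] costs the term in [u j.+1 - u j]. *)
  suff <- : lam j + tau j.+1 *: (B (u j) - p j.+1)
      = lam j + tau j.+1 *: (B (u j.+1) - p j.+1)
        - tau j.+1 *: B (u j.+1 - u j) by [].
  rewrite -addrA -scalerBr (linearB B); congr (_ + _); congr (_ *: _).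
  by rewrite opprB [RHS]addrC addrA subrK.
have G_fin j : G (u j) \is a fin_num.
  elim: j => [|j /step[_ []//]].
  exact: proper_fin_num.
have subF j := (step j (G_fin j)).1.
have subG j := (step j (G_fin j)).2.
pose R2 j := residual B tau u lam j ^+ 2.
have R2E j : R2 j.+1 = ipY (lam j.+1 - lam j) (lam j.+1 - lam j)
    + tau j.+1 ^+ 2 * ipY (B (u j.+1 - u j)) (B (u j.+1 - u j)).
  rewrite -!hY /R2 /residual sqr_sqrtr//.
  by apply: addr_ge0; [|apply: mulr_ge0]; apply: sqr_ge0.
have dlam j : lam j.+1 - lam j = tau j.+1 *: (B (u j.+1) - p j.+1).
  by rewrite (lamE j.+1 isT) addrC addKr.
have mono_lam j :
    ipY (lam j.+2 - lam j.+1) (B (u j.+2) - B (u j.+1)) <= 0.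
  have := subgradient_monotone (subG j) (subG j.+1).
  by rewrite !linearB /= !(dotE ipY); lra.
have R2_mono j : R2 j.+2 <= R2 j.+1.
  rewrite !R2E !dlam; apply: (residual_decrease hY) => //.
    exact: tau_mono.
    by rewrite -dlam linearB.
  (* Unfolding [lam j.+2] cancels [lam j.+1] in the difference of the subgradients, and p_{j+2} -
     p_{j+1} = w' - a' + a. *)
  have := subgradient_monotone (subF j) (subF j.+1).
  by rewrite (lamE j.+2 isT) /= !linearB /= !(dotE ipY); lra.
pose e j := lam j - lams.
pose x j := B (u j) - ps.
pose E j := ipY (e j) (e j) + tau j.+1 ^+ 2 * ipY (x j) (x j).
have E_ge0 j : 0 <= E j.
  by rewrite addr_ge0 ?(dot_ge0 hY)// mulr_ge0 ?sqr_ge0 ?(dot_ge0 hY).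
have E_decr j : R2 j.+2 + E j.+2 <= E j.+1.
  have eE : e j.+2 = e j.+1 + tau j.+2 *: (x j.+2 - (p j.+2 - ps)).
    by rewrite /e /x (lamE j.+2 isT) opprB addrA subrK addrAC.
  have dx : B (u j.+2 - u j.+1) = x j.+2 - x j.+1.
    by rewrite /x linearB /= opprB addrA subrK.
  have de : lam j.+2 - lam j.+1 = e j.+2 - e j.+1.
    by rewrite /e opprB addrA subrK.
  have decr : R2 j.+2 + (ipY (e j.+2) (e j.+2)
        + tau j.+2 ^+ 2 * ipY (x j.+2) (x j.+2)) <= E j.+1.
    rewrite R2E dx de; apply: (energy_decrease (tau_gt0 _) eE).
    - by rewrite -de -dx linearB.
    - have := subgradient_monotone subFs (subF j.+1).
      have := subgradient_monotone subGs (subG j.+1).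
      by rewrite /e /x !linearB /= Bus !(dotE ipY); lra.
  (* [decr] has the weight [tau j.+2] on both sides, while [E j.+2] carries the smaller
     [tau j.+3]. *)
  apply: le_trans decr; rewrite !lerD2l ler_wpM2r ?(dot_ge0 hY)// ler_sqr.
  - exact: tau_mono.
  - by rewrite nnegrE ltW.
  - by rewrite nnegrE ltW.
(* Telescoping [E_decr], with each of R_2^2, ..., R_{n+1}^2 bounded below by the last. *)
have sum_bound n : n%:R * R2 n.+1 + E n.+1 <= E 1%N.
  elim: n => [|n IH]; first by rewrite mul0r add0r.
  apply: le_trans IH; rewrite -natr1 mulrDl mul1r -addrA.
  by rewrite lerD ?ler_wpM2l.
(* For J >= 2, J <= 2 (J - 1) gives the factor 2; the [+ 1] makes the constant positive. *)
apply/eqO_exP; exists (2 * E 1%N + 1); first by have := E_ge0 1%N; lra.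
exists 2%N => // -[|[|n]]//= _.
rewrite ger0_norm ?sqr_ge0// ger0_norm ?invr_ge0// ler_pdivlMr ?ltr0n//.
have := sum_bound n.+1; have := E_ge0 n.+2; rewrite -/(R2 _) => h1 h2.
have : 0 <= n%:R * R2 n.+2 by rewrite mulr_ge0 ?sqr_ge0.
move: h2; rewrite -!natr1; have := E_ge0 1%N; lra.
Qed.
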